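(* Let $n,m\ge 1$, let $1\le p\le\infty$ and let $q=p/(p-1)$ be the conjugate exponent (with $q=\infty$ if $p=1$ and $q=1$ if $p=\infty$). Let $g_1,\dots,g_m\in\mathbb{R}^n$ be nonzero vectors and set $\hat g_i^{(p)}:=g_i/\|g_i\|_p$. Consider the problem $$\text{(P)}\qquad \max_{v\in\mathbb{R}^n,\;r\in\mathbb{R}}\ r\quad\text{s.t.}\quad (\hat g_i^{(p)})^\top v\ge r,\ i=1,\dots,m,\quad \|v\|_q\le 1 .$$ Then the (Lagrangian) dual of (P) is given by $$\text{(D)}\qquad \min_{\alpha\in\mathbb{R}^m}\ \Bigl\|\sum_{i=1}^m\alpha_i\hat g_i^{(p)}\Bigr\|_p\quad\text{s.t.}\quad \sum_{i=1}^m\alpha_i=1,\quad \alpha_i\ge 0,\ i=1,\dots,m .$$ Moreover, strong duality holds between (P) and (D), i.e. their optimal values coincide.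
   Context: $\|\cdot\|_p$ and $\|\cdot\|_q$ denote the $\ell_p$ and $\ell_q$ norms on $\mathbb{R}^n$. The Lagrangian of (P) is $$\mathcal L(v,r,\alpha,\beta)=r+\sum_{i=1}^m\alpha_i\bigl((\hat g_i^{(p)})^\top v-r\bigr)+\beta(1-\|v\|_q),\qquad \alpha_i\ge 0,\ \beta\ge 0,$$ the dual function is $\phi(\alpha,\beta)=\sup_{v,r}\mathcal L(v,r,\alpha,\beta)\in(-\infty,+\infty]$, and the dual problem is to minimize $\phi(\alpha,\beta)$ over $\alpha\ge 0,\ \beta\ge 0$. ''The dual is given by (D)'' means that, after minimizing over the scalar multiplier $\beta$ of the norm constraint for fixed $\alpha$, the dual problem is exactly (D); that is, for $\alpha\ge0$, $\inf_{\beta\ge 0}\phi(\alpha,\beta)$ equals $\|\sum_i\alpha_i\hat g_i^{(p)}\|_p$ if $\sum_i\alpha_i=1$ and $+\infty$ otherwise. *)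

(* Defs.v *)
From HB Require Import structures.
From mathcomp Require Import all_boot all_order all_algebra.
From mathcomp Require Import all_classical all_reals all_analysis.

Set Implicit Arguments.
Unset Strict Implicit.
Unset Printing Implicit Defensive.

Import Order.TTheory GRing.Theory Num.Theory.

Local Open Scope classical_set_scope.
Local Open Scope ring_scope.

(* Meaningful for 1 <= p <= +oo; the value at -oo is a dummy. *)
Definition lpnorm (R : realType) (n : nat) (p : \bar R) (v : 'cV[R]_n) : R :=
  match p with
  | p'%:E => (\sum_(i < n) `|v i 0| `^ p') `^ p'^-1
  | +oo%E => \big[Num.max/0]_(i < n) `|v i 0|
  | -oo%E => 0
  end.

Definition lpnormalize (R : realType) (n : nat) (p : \bar R) (v : 'cV[R]_n) :
    'cV[R]_n :=
  (lpnorm p v)^-1 *: v.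

Definition dotprod (R : realType) (n : nat) (u v : 'cV[R]_n) : R :=
  (u^T *m v) 0 0.

Definition primal_feasible (R : realType) (n m : nat) (p : \bar R)
    (g : 'I_m -> 'cV[R]_n) : set ('cV[R]_n * R) :=
  [set x | (forall i, x.2 <= dotprod (lpnormalize p (g i)) x.1) /\
           lpnorm (hoelder_conjugate p) x.1 <= 1].

Definition primal_value (R : realType) (n m : nat) (p : \bar R)
    (g : 'I_m -> 'cV[R]_n) : \bar R :=
  ereal_sup [set x.2%:E | x in primal_feasible p g].

Definition lagrangian (R : realType) (n m : nat) (p : \bar R)
    (g : 'I_m -> 'cV[R]_n) (v : 'cV[R]_n) (r : R) (alpha : 'cV[R]_m)
    (beta : R) : R :=
  r + \sum_(i < m) alpha i 0 * (dotprod (lpnormalize p (g i)) v - r)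
    + beta * (1 - lpnorm (hoelder_conjugate p) v).

Definition dual_function (R : realType) (n m : nat) (p : \bar R)
    (g : 'I_m -> 'cV[R]_n) (alpha : 'cV[R]_m) (beta : R) : \bar R :=
  ereal_sup [set (lagrangian p g x.1 x.2 alpha beta)%:E
            | x in [set: 'cV[R]_n * R]].

Definition dual_objective (R : realType) (n m : nat) (p : \bar R)
    (g : 'I_m -> 'cV[R]_n) (alpha : 'cV[R]_m) : R :=
  lpnorm p (\sum_(i < m) alpha i 0 *: lpnormalize p (g i)).

Definition dual_feasible (R : realType) (m : nat) : set 'cV[R]_m :=
  [set alpha | \sum_(i < m) alpha i 0 = 1 /\ forall i, 0 <= alpha i 0].

Definition dual_value (R : realType) (n m : nat) (p : \bar R)
    (g : 'I_m -> 'cV[R]_n) : \bar R :=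
  ereal_inf [set (dual_objective p g alpha)%:E | alpha in @dual_feasible R m].

(* Main.v *)
(** With w = sum_i alpha_i u_i, u_i the normalized vectors, the Lagrangian is
    (1 - sum_i alpha_i) r + <w, v> + beta (1 - |v|_q). If sum_i alpha_i <> 1 it
    is unbounded in r. Otherwise Hoelder's inequality gives the value |w|_p at
    beta = |w|_p, and a v in the unit q-ball with <w, v> = |w|_p shows that no
    beta does better.

    Strong duality is a minimax statement. If d is at most the dual value, every
    alpha >= 0 is answered by some v in the q-ball with
    sum_i alpha_i (<u_i, v> - d) >= 0. By Blackwell's approachability argument,
    the convex set of payoff vectors (<u_i, v> - d)_i then comes arbitrarily
    close to the nonnegative orthant. This gives (v, d - e) feasible for the
    primal for every e > 0, with no compactness or separation theorem. *)

Require Import Defs.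
From HB Require Import structures.
From mathcomp Require Import all_boot all_order all_algebra.
From mathcomp Require Import all_classical all_reals all_analysis.
From mathcomp Require Import ring lra.

Set Implicit Arguments.
Unset Strict Implicit.
Unset Printing Implicit Defensive.

Import Order.TTheory GRing.Theory Num.Theory.

Local Open Scope classical_set_scope.
Local Open Scope ring_scope.

(** * Bilinearity of the dot product *)

Section dotprod.
Variables (R : realType) (n : nat).
Implicit Types (u v w : 'cV[R]_n) (a : R).

Lemma dotprodE u v : dotprod u v = \sum_i u i 0 * v i 0.
Proof. by rewrite /dotprod mxE; apply: eq_bigr => i _; rewrite mxE. Qed.

Lemma dotprodC u v : dotprod u v = dotprod v u.
Proof. by rewrite !dotprodE; apply: eq_bigr => i _; rewrite mulrC. Qed.

Lemma dotprodDr u v w : dotprod u (v + w) = dotprod u v + dotprod u w.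
Proof. by rewrite /dotprod mulmxDr mxE. Qed.

Lemma dotprodZr a u v : dotprod u (a *: v) = a * dotprod u v.
Proof. by rewrite /dotprod -scalemxAr mxE. Qed.

Lemma dotprod0r u : dotprod u 0 = 0.
Proof. by rewrite /dotprod mulmx0 mxE. Qed.

Lemma dotprodNr u v : dotprod u (- v) = - dotprod u v.
Proof. by rewrite -scaleN1r dotprodZr mulN1r. Qed.

Lemma dotprod_suml m (a : 'I_m -> R) (u : 'I_m -> 'cV[R]_n) v :
  dotprod (\sum_i a i *: u i) v = \sum_i a i * dotprod (u i) v.
Proof.
rewrite dotprodC /dotprod mulmx_sumr summxE; apply: eq_bigr => i _.
by rewrite -scalemxAr mxE; congr (_ * _); exact: dotprodC.
Qed.

End dotprod.

Lemma powR_rootV (R : realType) (x r : R) : 0 <= x -> r != 0 ->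
  (x `^ r^-1)^-1 `^ r = x^-1.
Proof. by move=> x0 r0; rewrite -powRN -powRrM mulNr mulVf// powR_inv1. Qed.

(** * The norms and Hoelder's inequality *)

Section lpnorm.
Variables (R : realType) (n : nat).
Implicit Types (u v w : 'cV[R]_n) (p : \bar R).

Lemma lpnorm_ge0 p v : 0 <= lpnorm p v.
Proof.
case: p => [p| |] //=; first exact: powR_ge0.
exact: bigmax_ge_id.
Qed.

Lemma lpnormN p v : lpnorm p (- v) = lpnorm p v.
Proof.
have vN i : `|(- v) i 0| = `|v i 0| by rewrite mxE normrN.
by case: p => [p| |]; rewrite /lpnorm; do ?under eq_bigr do rewrite vN.
Qed.

Lemma lpnorm1 v : lpnorm 1%E v = \sum_i `|v i 0|.
Proof.
rewrite /= invr1 powRr1; last by apply: sumr_ge0 => i _; exact: powR_ge0.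
by apply: eq_bigr => i _; rewrite powRr1.
Qed.

Lemma dotprod_le_norm u v : dotprod u v <= \sum_i `|u i 0| * `|v i 0|.
Proof.
by rewrite dotprodE; apply: ler_sum => i _; rewrite -normrM ler_norm.
Qed.

Lemma dotprod_lpnorm1 u v : dotprod u v <= lpnorm 1%E u * lpnorm +oo%E v.
Proof.
rewrite (le_trans (dotprod_le_norm _ _))// lpnorm1 mulr_suml.
apply: ler_sum => i _; apply: ler_wpM2l => //.
exact: (le_bigmax_cond _ (fun i => `|v i 0|)).
Qed.

Lemma sum_powR_eq0 (p : R) v : 0 < p ->
  \sum_i `|v i 0| `^ p = 0 -> forall i, v i 0 = 0.
Proof.
move=> p0 /psumr_eq0P v0 i; apply: normr0_eq0.
by apply: (@powR_eq0_eq0 _ _ p); apply: v0 => // j _; exact: powR_ge0.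
Qed.

(** Once both vectors are divided by their norms, Young's inequality bounds each product, and these
    bounds sum to [p^-1 + q^-1 = 1]. A vector of norm 0 cannot be normalized and is treated
    apart. *)
Lemma dotprod_lpnorm_fin (p q : R) u v : 0 < p -> 0 < q -> p^-1 + q^-1 = 1 ->
  dotprod u v <= lpnorm p%:E u * lpnorm q%:E v.
Proof.
move=> p0 q0 pq; rewrite (le_trans (dotprod_le_norm _ _))//=.
have S0 r w : 0 <= \sum_i `|w i (0 : 'I_1)| `^ r.
  by apply: sumr_ge0 => i _; exact: powR_ge0.
set S := \sum_i `|u i 0| `^ p; set T := \sum_i `|v i 0| `^ q.
have [S_eq0|S_neq0] := eqVneq S 0.
  rewrite big1 => [|i _]; first by rewrite mulr_ge0 ?powR_ge0.
  by rewrite (sum_powR_eq0 p0 S_eq0) normr0 mul0r.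
have [T_eq0|T_neq0] := eqVneq T 0.
  rewrite big1 => [|i _]; first by rewrite mulr_ge0 ?powR_ge0.
  by rewrite (sum_powR_eq0 q0 T_eq0) normr0 mulr0.
have S_gt0 : 0 < S by rewrite lt_def S_neq0 S0.
have T_gt0 : 0 < T by rewrite lt_def T_neq0 S0.
set N := S `^ p^-1; set M := T `^ q^-1.
have N_gt0 : 0 < N by exact: powR_gt0.
have M_gt0 : 0 < M by exact: powR_gt0.
have NE : N^-1 `^ p = S^-1 by rewrite powR_rootV ?gt_eqF ?S0.
have ME : M^-1 `^ q = T^-1 by rewrite powR_rootV ?gt_eqF ?S0.
clearbody N M.
have NM_gt0 : 0 < N * M by rewrite mulr_gt0.
rewrite -[leRHS]mul1r -ler_pdivrMr// mulr_suml.
have -> : 1 = \sum_i (`|u i 0| `^ p / S / p + `|v i 0| `^ q / T / q).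
  by rewrite big_split/= -!mulr_suml !divff// !mul1r pq.
apply: ler_sum => i _.
rewrite invfM mulrACA; apply: le_trans.
  apply: (@conjugate_powR _ _ _ p q) => //;
    by rewrite mulr_ge0// invr_ge0 ltW.
by rewrite !powRM ?NE ?ME// invr_ge0 ltW.
Qed.

Lemma hoelder_conjugate_fin (p : R) : 1 < p ->
  hoelder_conjugate p%:E = (p / (p - 1))%:E.
Proof.
move=> p1; rewrite /hoelder_conjugate/= eqe gt_eqF ?(lt_trans _ p1)//.
by rewrite -EFinD inver subr_eq0 gt_eqF.
Qed.

Lemma dotprod_lpnorm p u v : (1 <= p)%E ->
  dotprod u v <= lpnorm p u * lpnorm (hoelder_conjugate p) v.
Proof.
case: p => [p| |] //; last first.
  by move=> _; rewrite hoelder_conjugatey mulrC dotprodC dotprod_lpnorm1.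
rewrite lee_fin le_eqVlt => /predU1P[<-|p1].
  by rewrite hoelder_conjugate1 dotprod_lpnorm1.
have p0 : 0 < p by rewrite (lt_trans _ p1).
have p10 : 0 < p - 1 by rewrite subr_gt0.
rewrite hoelder_conjugate_fin//.
apply: dotprod_lpnorm_fin => //; first exact: divr_gt0.
by field; rewrite !gt_eqF.
Qed.

(** * Equality in Hoelder's inequality and duality of the norms *)

Lemma lpnorm1_attained w : exists2 v,
  lpnorm +oo%E v <= 1 & dotprod w v = lpnorm 1%E w.
Proof.
exists (\col_i Num.sg (w i 0)).
  by apply: bigmax_le => // i _; rewrite mxE normr_sg; case: (_ != 0).
rewrite lpnorm1 dotprodE; apply: eq_bigr => i _.
by rewrite mxE mulrC -normrEsg.
Qed.

Lemma lpnormy_attained w : exists2 v,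
  lpnorm 1%E v <= 1 & dotprod w v = lpnorm +oo%E w.
Proof.
(* Norm 0 is split off because for [n = 0] there is no coordinate to pick. Otherwise the witness is
   a signed basis vector at a coordinate of largest modulus. *)
have [w0|w0] := leP (lpnorm +oo%E w) 0.
  exists 0; first by rewrite lpnorm1 big1// => i _; rewrite mxE normr0.
  by apply/eqP; rewrite dotprod0r eq_le w0 lpnorm_ge0.
have [k wk] : exists k, lpnorm +oo%E w = `|w k 0|.
  case: (pickP 'I_n) => [j _|noI].
    by eexists; rewrite /= (@bigmax_eq_arg _ _ _ _ j).
  by move: w0; rewrite /= big_pred0 ?ltxx.
exists (\col_i (Num.sg (w k 0) *+ (i == k))).
  rewrite lpnorm1 (bigD1 k)//= big1 => [|i ik].
    by rewrite mxE eqxx mulr1n normr_sg addr0; case: (_ != 0).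
  by rewrite mxE (negbTE ik) mulr0n normr0.
rewrite wk dotprodE (bigD1 k)//= big1 => [|i ik].
  by rewrite mxE eqxx mulr1n addr0 mulrC -normrEsg.
by rewrite mxE (negbTE ik) mulr0n mulr0.
Qed.

(** Equality in Young's inequality forces [v] to be proportional to the signed powers of exponent
    [p - 1] of the entries of [w]; then [(p - 1) * q = p] turns the sum of [q]-th powers of [v] into
    [S / S]. *)
Lemma lpnorm_fin_attained (p : R) w : 1 < p -> exists2 v,
  lpnorm (p / (p - 1))%:E v <= 1 & dotprod w v = lpnorm p%:E w.
Proof.
move=> p1; have p0 : 0 < p by rewrite (lt_trans _ p1).
have p10 : 0 < p - 1 by rewrite subr_gt0.
set q := p / (p - 1); have q0 : 0 < q by exact: divr_gt0.
have pq : 1 - q^-1 = p^-1 by rewrite /q; field; rewrite !gt_eqF.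
set S := \sum_i `|w i 0| `^ p.
have S_ge0 : 0 <= S by apply: sumr_ge0 => i _; exact: powR_ge0.
(* Dividing by 0 when [S = 0] is harmless: it makes the witness 0. *)
exists (\col_i (Num.sg (w i 0) * `|w i 0| `^ (p - 1) / S `^ q^-1)).
  rewrite /= -[leRHS](_ : 1 `^ q^-1 = 1); last by rewrite powR1.
  rewrite ge0_ler_powR ?nnegrE ?invr_ge0 ?(ltW q0)//.
    by apply: sumr_ge0 => i _; exact: powR_ge0.
  (* The bound [S / S] is 0 when [S = 0] and 1 otherwise. *)
  apply: (@le_trans _ _ (S / S)).
    rewrite mulr_suml; apply: ler_sum => i _.
    have -> : `|w i 0| `^ p = (`|w i 0| `^ (p - 1)) `^ q.
      by rewrite -powRrM /q mulrC divfK// gt_eqF.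
    rewrite -(@powR_rootV _ S q) ?gt_eqF// -powRM ?invr_ge0 ?powR_ge0//.
    rewrite ge0_ler_powR ?nnegrE ?(ltW q0) ?mulr_ge0 ?invr_ge0 ?powR_ge0//.
    rewrite mxE !normrM normfV !(ger0_norm (powR_ge0 _ _)).
    rewrite ler_wpM2r ?invr_ge0 ?powR_ge0// ler_piMl ?powR_ge0// normr_sg.
    by case: (_ != 0).
  have [->|S0] := eqVneq S 0; first by rewrite mul0r.
  by rewrite divff.
rewrite dotprodE /= -/S -pq.
under eq_bigr do
  rewrite mxE !mulrA [w _ _ * _]mulrC -normrEsg mulr_powRB1//.
rewrite -mulr_suml -/S; have [->|S0] := eqVneq S 0.
  by rewrite mul0r pq powR0// invr_eq0 gt_eqF.
by rewrite powRB ?S0 ?implybT// powRr1.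
Qed.

Lemma dual_lpnorm_attained p w : (1 <= p)%E -> exists2 v,
  lpnorm (hoelder_conjugate p) v <= 1 & dotprod w v = lpnorm p w.
Proof.
case: p => [p| |] //; last first.
  by move=> _; rewrite hoelder_conjugatey; exact: lpnormy_attained.
rewrite lee_fin le_eqVlt => /predU1P[<-|p1].
  by rewrite hoelder_conjugate1; exact: lpnorm1_attained.
by rewrite hoelder_conjugate_fin//; exact: lpnorm_fin_attained.
Qed.

(** The conjugate of [q] is [p], so the [q]-norm of [v] is attained at some [u] in the unit
    [p]-ball. *)
Lemma dual_lpnorm_le p v c : (1 <= p)%E -> 0 <= c ->
    (forall u, lpnorm p u <= 1 -> dotprod u v <= c) ->
  lpnorm (hoelder_conjugate p) v <= c.
Proof.
move=> p1 c0 vc.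
have [u u1 <-] := dual_lpnorm_attained v (hoelder_conj_ge1 p1).
by rewrite dotprodC vc// -(hoelder_conjugateK p).
Qed.

Lemma lpnorm0 p : (1 <= p)%E -> lpnorm p (0 : 'cV[R]_n) = 0.
Proof.
by move=> p1; have [v _ <-] := dual_lpnorm_attained 0 p1; rewrite dotprodC dotprod0r.
Qed.

Lemma dotprod_dual_ball p u v : (1 <= p)%E ->
  lpnorm (hoelder_conjugate p) v <= 1 -> dotprod u v <= lpnorm p u.
Proof.
move=> p1 v1; rewrite (le_trans (dotprod_lpnorm _ _ p1))//.
by rewrite ler_piMr// lpnorm_ge0.
Qed.

(* Convexity comes from the dual description of the norm, not from Minkowski. *)
Lemma dual_ball_convex p v w t : (1 <= p)%E ->
    lpnorm (hoelder_conjugate p) v <= 1 ->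
    lpnorm (hoelder_conjugate p) w <= 1 -> 0 <= t <= 1 ->
  lpnorm (hoelder_conjugate p) ((1 - t) *: v + t *: w) <= 1.
Proof.
move=> p1 v1 w1 /andP[t0 t1]; apply: dual_lpnorm_le => // u u1.
have uv := le_trans (dotprod_dual_ball u p1 v1) u1.
have uw := le_trans (dotprod_dual_ball u p1 w1) u1.
rewrite dotprodDr !dotprodZr; nra.
Qed.

End lpnorm.

(** * Approachability of the nonnegative orthant *)

(* If d > 0 is the infimum over X of the squared distance to the orthant, then
   moving from x a fraction t towards the answer to the direction [neg x] gives
   d <= (1 - t)^2 d + t^2 M, which fails for small t. *)
Lemma orthant_approachable (R : realType) (m : nat) (X : set 'cV[R]_m) (M : R) :
    (forall x y t, X x -> X y -> 0 <= t <= 1 -> X ((1 - t) *: x + t *: y)) ->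
    (forall x, X x -> \sum_i x i 0 ^+ 2 <= M) ->
    (forall a : 'cV[R]_m, (forall i, 0 <= a i 0) ->
       exists2 x, X x & 0 <= \sum_i a i 0 * x i 0) ->
  forall e, 0 < e -> exists2 x, X x & forall i, - e <= x i 0.
Proof.
move=> Xconv XM Xresp e e0.
(* [neg x] leads from [x] to the nearest point of the orthant, so [D x] is the squared distance. *)
pose neg (x : 'cV[R]_m) := \col_i Num.max 0 (- x i 0).
pose D x := \sum_i neg x i 0 ^+ 2.
have neg_ge0 x i : 0 <= neg x i 0 by rewrite mxE le_max lexx.
have [[x Xx Dx]|far] := pselect (exists2 x, X x & D x < e ^+ 2).
  exists x => // i; rewrite lerNl.
  have : neg x i 0 ^+ 2 < e ^+ 2.
    apply: le_lt_trans Dx; rewrite /D (bigD1 i)//= lerDl.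
    by apply: sumr_ge0 => j _; exact: sqr_ge0.
  rewrite ltr_sqr ?nnegrE ?(ltW e0)// mxE gt_max => /andP[_].
  exact: ltW.
exfalso.
have De x : X x -> e ^+ 2 <= D x.
  by move=> Xx; rewrite leNgt; apply/negP => Dx; apply: far; exists x.
(* The answer to the zero direction shows that [X] is nonempty. *)
have [x0 Xx0 _] : exists2 x, X x & 0 <= \sum_i (0 : 'cV[R]_m) i 0 * x i 0.
  by apply: Xresp => i; rewrite mxE.
have M0 : 0 <= M.
  by apply: le_trans (XM _ Xx0); apply: sumr_ge0 => i _; exact: sqr_ge0.
pose d := inf [set D x | x in X].
have dE : e ^+ 2 <= d.
  by apply: lb_le_inf; [exists (D x0), x0|move=> _ [x Xx <-]; exact: De].
have d0 : 0 < d by apply: lt_le_trans dE; rewrite exprn_gt0.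
have dD x : X x -> d <= D x.
  move=> Xx; apply: ge_inf; last by exists x.
  by exists (e ^+ 2) => _ [y Xy <-]; exact: De.
have step x t : X x -> 0 <= t <= 1 -> d <= (1 - t) ^+ 2 * D x + t ^+ 2 * M.
  move=> Xx /andP[t0 t1].
  have [y Xy xy] := Xresp (neg x) (neg_ge0 x).
  have Xz : X ((1 - t) *: x + t *: y) by apply: Xconv => //; rewrite t0.
  apply: (le_trans (dD _ Xz)).
  (* Each negative part of the new point is either 0 or at most the term being squared. After
     expansion, the cross term has a favourable sign by the choice of [y]. *)
  apply: (@le_trans _ _ (\sum_i ((1 - t) * neg x i 0 - t * y i 0) ^+ 2)).
    apply: ler_sum => i _.
    have := neg_ge0 x i; have : - x i 0 <= neg x i 0 by rewrite mxE le_max lexx orbT.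
    rewrite [neg (_ + _) i 0]mxE !mxE.
    set a := Num.max 0 (- x i 0) => xa a0.
    have t1' : 0 <= 1 - t by lra.
    have H : - ((1 - t) * x i 0 + t * y i 0) <= (1 - t) * a - t * y i 0 by nra.
    have [z0|z0] := leP (- ((1 - t) * x i 0 + t * y i 0)) 0.
      by rewrite expr0n/= sqr_ge0.
    by rewrite ler_sqr ?nnegrE ?(ltW z0)// (le_trans _ H) ?(ltW z0).
  have -> : \sum_i ((1 - t) * neg x i 0 - t * y i 0) ^+ 2 =
      (1 - t) ^+ 2 * D x - 2 * t * (1 - t) * (\sum_i neg x i 0 * y i 0)
      + t ^+ 2 * \sum_i y i 0 ^+ 2.
    rewrite /D !mulr_sumr -sumrN -!big_split/=.
    by apply: eq_bigr => i _; ring.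
  have := XM _ Xy; move: xy; set A := \sum_i _; set B := \sum_i _ => A0 BM.
  have : 0 <= t * (1 - t) * A by rewrite !mulr_ge0// subr_ge0.
  have : t ^+ 2 * B <= t ^+ 2 * M by rewrite ler_wpM2l ?sqr_ge0.
  lra.
(* This gives [t * (d + M) < d], while [step] at the infimum yields [2 * d <= t * (d + M)]. *)
pose t := d / (d + M + 1).
have dM : 0 < d + M + 1 by lra.
have t0 : 0 < t by exact: divr_gt0.
have tE : t * (d + M + 1) = d by rewrite /t mulfVK// gt_eqF.
have t1 : t < 1 by rewrite /t ltr_pdivrMr// mul1r; lra.
have t1' : 0 < (1 - t) ^+ 2 by rewrite exprn_gt0// subr_gt0.
have : (d - t ^+ 2 * M) / (1 - t) ^+ 2 <= d.
  apply: lb_le_inf; first by exists (D x0), x0.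
  move=> _ [x Xx <-]; rewrite ler_pdivrMr// lerBlDr mulrC step// (ltW t0).
  exact: ltW.
rewrite ler_pdivrMr// => H.
have : 0 < t * d by exact: mulr_gt0.
nra.
Qed.

(** * The dual function *)

Section lagrangian_dual.
Variables (R : realType) (n m : nat) (p : \bar R) (g : 'I_m -> 'cV[R]_n).
Hypothesis p1 : (1 <= p)%E.
Local Notation q := (hoelder_conjugate p).
Local Notation u i := (lpnormalize p (g i)).

Lemma lagrangianE v r (alpha : 'cV[R]_m) beta :
  lagrangian p g v r alpha beta =
    (1 - \sum_i alpha i 0) * r + dotprod (\sum_i alpha i 0 *: u i) v
    + beta * (1 - lpnorm q v).
Proof.
rewrite /lagrangian dotprod_suml; congr (_ + _).
under eq_bigr do rewrite mulrBr.
by rewrite sumrB -mulr_suml; ring.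
Qed.

Lemma dual_function_unbounded (alpha : 'cV[R]_m) beta :
  \sum_i alpha i 0 != 1 -> dual_function p g alpha beta = +oo%E.
Proof.
move=> alpha1; apply: eq_infty => K.
apply: ereal_sup_ubound => /=.
pose s := 1 - \sum_i alpha i 0.
have s0 : s != 0 by rewrite subr_eq0 eq_sym.
(* At [v = 0] the Lagrangian is affine in [r] with slope [s]; this [r] gives it the value [K]. *)
exists (0, (K - beta * (1 - lpnorm q (0 : 'cV[R]_n))) / s) => //=.
by rewrite lagrangianE dotprod0r addr0 -/s mulrC divfK// subrK.
Qed.

Lemma inf_dual_function (alpha : 'cV[R]_m) : \sum_i alpha i 0 = 1 ->
  ereal_inf [set dual_function p g alpha beta | beta in [set b : R | 0 <= b]]
  = (dual_objective p g alpha)%:E.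
Proof.
move=> alpha1; apply/eqP; rewrite eq_le; apply/andP; split.
  apply: ge_ereal_inf; exists (dual_function p g alpha (dual_objective p g alpha)).
    by exists (dual_objective p g alpha) => //; exact: lpnorm_ge0.
  apply: ge_ereal_sup => _ [[v r] _ <-].
  rewrite lee_fin lagrangianE/= alpha1 subrr mul0r add0r.
  by rewrite mulrBr mulr1 addrCA gerDl subr_le0 dotprod_lpnorm.
apply: le_ereal_inf_tmp => _ [beta beta0 <-].
have [v v1 vE] := dual_lpnorm_attained (\sum_i alpha i 0 *: u i) p1.
apply: (@le_trans _ _ (lagrangian p g v 0 alpha beta)%:E).
  rewrite lee_fin lagrangianE mulr0 add0r vE lerDl.
  by rewrite mulr_ge0// subr_ge0.
by apply: ereal_sup_ubound; exists (v, 0).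
Qed.

(** * Weak and strong duality *)

Lemma weak_duality : (primal_value p g <= dual_value p g)%E.
Proof.
apply: ge_ereal_sup => _ [[v r] /= [ru v1] <-].
apply: le_ereal_inf_tmp => _ [alpha [alpha1 alpha0] <-].
rewrite lee_fin; apply: le_trans (dotprod_dual_ball _ p1 v1).
rewrite dotprod_suml -[leLHS]mul1r -alpha1 mulr_suml.
by apply: ler_sum => i _; rewrite ler_wpM2l.
Qed.

Lemma primal_approx (d e : R) : 0 < e ->
    (forall alpha, dual_feasible alpha -> d <= dual_objective p g alpha) ->
  exists v, primal_feasible p g (v, d - e).
Proof.
move=> e0 dle.
pose payoff v : 'cV[R]_m := \col_i (dotprod (u i) v - d).
have : exists2 x, [set payoff v | v in [set v | lpnorm q v <= 1]] x &
    forall i, - e <= x i 0.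
  apply: (@orthant_approachable _ _ _ (\sum_i (lpnorm p (u i) + `|d|) ^+ 2)) => //.
  - move=> _ _ t [v v1 <-] [w w1 <-] t01.
    exists ((1 - t) *: v + t *: w); first exact: dual_ball_convex.
    by apply/colP => i; rewrite !mxE dotprodDr !dotprodZr; ring.
  - move=> _ [v v1 <-]; apply: ler_sum => i _.
    rewrite mxE -[leLHS]real_normK ?num_real// ler_sqr ?nnegrE ?addr_ge0 ?lpnorm_ge0//.
    rewrite (le_trans (ler_normB _ _))// lerD2r ler_norml dotprod_dual_ball//.
    (* The lower bound is the upper bound for the opposite of [v]. *)
    rewrite andbT lerNl -dotprodNr dotprod_dual_ball//.
    by rewrite lpnormN.
  - move=> a a0; pose A := \sum_i a i 0.
    have A0 : 0 <= A by exact: sumr_ge0.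
    have [AE|A_neq0] := eqVneq A 0.
      exists (payoff 0); first by exists 0; rewrite //= lpnorm0// hoelder_conj_ge1.
      rewrite big1// => i _.
      by rewrite (psumr_eq0P _ AE) ?mul0r.
    have A_gt0 : 0 < A by rewrite lt_def A_neq0.
    (* Rescaling to total weight 1 makes the hypothesis on [d] applicable; the [v] attaining the
       resulting norm is the answer to [a]. *)
    have feas : dual_feasible (A^-1 *: a).
      split=> [|i]; last by rewrite mxE mulr_ge0// invr_ge0.
      by under eq_bigr do rewrite mxE; rewrite -mulr_sumr mulVf.
    have := dle _ feas; rewrite /dual_objective.
    have [v v1 <- H] := dual_lpnorm_attained
      (\sum_i (A^-1 *: a) i 0 *: u i) p1.
    exists (payoff v); first by exists v.
    under eq_bigr do rewrite mxE mulrBr.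
    rewrite sumrB -mulr_suml subr_ge0 -/A.
    move: H; rewrite dotprod_suml; under eq_bigr do rewrite mxE -mulrA.
    by rewrite -mulr_sumr ler_pdivlMl.
move=> [_ [v v1 <-] ve]; exists v; split=> // i /=.
by have := ve i; rewrite mxE; lra.
Qed.

(** A basis vector is dual feasible since [0 < m], so the dual value is the real number [inf D]. By
    [primal_approx] the primal value is at least [inf D - e] for every [e > 0]. *)
Lemma strong_duality : (0 < m)%N -> primal_value p g = dual_value p g.
Proof.
move=> m0; apply/eqP; rewrite eq_le weak_duality/=.
rewrite /dual_value -(image_comp (dual_objective p g) EFin).
set D := [set dual_objective p g alpha | alpha in @dual_feasible R m];
  have lbD : has_lbound D.
  by exists 0 => _ [alpha _ <-]; exact: lpnorm_ge0.
rewrite ereal_inf_EFin//; last first.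
  exists (dual_objective p g (delta_mx (Ordinal m0) 0)), (delta_mx (Ordinal m0) 0) => //.
  split=> [|i]; last by rewrite mxE ler0n.
  rewrite (bigD1 (Ordinal m0))//= big1 => [|i im].
    by rewrite mxE !eqxx addr0.
  by rewrite mxE (negbTE im).
apply/lee_addgt0Pr => e e0; rewrite -leeBlDr//.
have [|v vP] := @primal_approx (inf D) e e0.
  by move=> alpha aP; apply: ge_inf => //; exists alpha.
by apply: ereal_sup_ubound; exists (v, inf D - e).
Qed.

End lagrangian_dual.

Theorem proposition3p2 (R : realType) (n m : nat) (hn : (1 <= n)%N)
    (hm : (1 <= m)%N) (p : \bar R) (hp : (1 <= p)%E)
    (g : 'I_m -> 'cV[R]_n) (hg : forall i, g i != 0) :
  (forall alpha : 'cV[R]_m, (forall i, 0 <= alpha i 0) ->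
     ereal_inf [set dual_function p g alpha beta | beta in [set b : R | 0 <= b]]
     = if \sum_(i < m) alpha i 0 == 1 then (dual_objective p g alpha)%:E
       else +oo%E) /\
  primal_value p g = dual_value p g.
Proof.
split; last exact: strong_duality.
move=> alpha _; case: eqP => [alpha1|/eqP alpha1].
  exact: inf_dual_function.
apply/ereal_inf_pinfty => _ [beta _ <-].
exact: dual_function_unbounded.
Qed.
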